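(* Let $Q$ be a restriction quantal frame and let $\mathsf{C}(Q)$ be the set of completely prime filters of $Q$. For $A,B\in\mathsf{C}(Q)$ define $\mathbf{d}(A)=(A^{\ast})^{\uparrow}$, $\mathbf{r}(A)=(A^{+})^{\uparrow}$, and, when $\mathbf{d}(A)=\mathbf{r}(B)$ (equivalently $A^{\ast}=B^{+}$), $A\cdot B=(AB)^{\uparrow}$, otherwise undefined. Then $A\cdot B$ is always a completely prime filter when defined, and $(\mathsf{C}(Q),\cdot)$ is a category whose identities are exactly the identity completely prime filters, with $\mathbf{d}(A)$ and $\mathbf{r}(A)$ the right and left identities of $A$.
   Context: A restriction quantal frame is a frame $(Q,\le)$ with associative multiplication distributing over arbitrary joins on both sides, which is a monoid with identity $e$ and carries join-preserving unary operations $a\mapsto a^{\ast}$, $a\mapsto a^{+}$ with values in the set $e^{\downarrow}=\{x:x\le e\}$ of projections (a commutative subsemigroup of idempotents), fixing projections, with $aa^{\ast}=a$, $a^{+}a=a$, $(ab)^{\ast}=(a^{\ast}b)^{\ast}$, $(ab)^{+}=(ab^{+})^{+}$; the top element is a join of partial isometries ($a$ with $b\le a\Rightarrow b=b^{+}a=ab^{\ast}$) and partial isometries are closed under product. A completely prime filter is a nonempty upward closed subset closed under binary meets, not containing $0$, such that whenever $\bigvee_i a_i$ lies in it some $a_i$ does; it is an identity completely prime filter if it contains a projection. Notation: $A^{\ast}=\{a^{\ast}:a\in A\}$, $A^{+}=\{a^{+}:a\in A\}$, $AB=\{ab:a\in A,b\in B\}$, $X^{\uparrow}=\{y:\exists x\in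 X,\ x\le y\}$. *)

(* Defs.v *)
Set Implicit Arguments.

Definition img {T U : Type} (f : T -> U) (S : T -> Prop) : U -> Prop :=
  fun y => exists s, S s /\ y = f s.

Record RQF := {
  car :> Type;
  le : car -> car -> Prop;
  join : (car -> Prop) -> car;
  meet : car -> car -> car;
  mul : car -> car -> car;
  e : car;
  star : car -> car;
  plus : car -> car;
  le_refl : forall a, le a a;
  le_trans : forall a b c, le a b -> le b c -> le a c;
  le_antisym : forall a b, le a b -> le b a -> a = b;
  join_ub : forall S a, S a -> le a (join S);
  join_least : forall S b, (forall a, S a -> le a b) -> le (join S) b;
  meet_lb1 : forall a b, le (meet a b) a;
  meet_lb2 : forall a b, le (meet a b) b;
  meet_greatest : forall a b c, le c a -> le c b -> le c (meet a b);
  meet_join_distr : forall a S, meet a (join S) = join (img (meet a) S);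
  mulA : forall a b c, mul a (mul b c) = mul (mul a b) c;
  mul_join_l : forall a S, mul a (join S) = join (img (mul a) S);
  mul_join_r : forall a S, mul (join S) a = join (img (fun s => mul s a) S);
  mul_e_l : forall a, mul e a = a;
  mul_e_r : forall a, mul a e = a;
  proj_mul_closed : forall a b, le a e -> le b e -> le (mul a b) e;
  proj_comm : forall a b, le a e -> le b e -> mul a b = mul b a;
  proj_idem : forall a, le a e -> mul a a = a;
  star_join : forall S, star (join S) = join (img star S);
  plus_join : forall S, plus (join S) = join (img plus S);
  star_proj : forall a, le (star a) e;
  plus_proj : forall a, le (plus a) e;
  star_fix : forall a, le a e -> star a = a;
  plus_fix : forall a, le a e -> plus a = a;
  mul_star : forall a, mul a (star a) = a;
  plus_mul : forall a, mul (plus a) a = a;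
  star_mul : forall a b, star (mul a b) = star (mul (star a) b);
  plus_mul2 : forall a b, plus (mul a b) = plus (mul a (plus b));
  (* partial isometries *)
  top_pi : join (fun _ => True) =
           join (fun a => forall b, le b a -> b = mul (plus b) a /\ b = mul a (star b));
  pi_mul : forall a b,
     (forall c, le c a -> c = mul (plus c) a /\ c = mul a (star c)) ->
     (forall c, le c b -> c = mul (plus c) b /\ c = mul b (star c)) ->
     (forall c, le c (mul a b) -> c = mul (plus c) (mul a b) /\ c = mul (mul a b) (star c))
}.

Arguments le {r}. Arguments join {r}. Arguments meet {r}. Arguments mul {r}.
Arguments star {r}. Arguments plus {r}.

Section Filters.
Variable Q : RQF.

Definition bot : Q := join (fun _ : Q => False).

Definition cpf (F : Q -> Prop) : Prop :=
  (exists a, F a) /\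
  (forall a b, F a -> le a b -> F b) /\
  (forall a b, F a -> F b -> F (meet a b)) /\
  ~ F bot /\
  (forall S, F (join S) -> exists a, S a /\ F a).

Definition identity_cpf (F : Q -> Prop) : Prop := cpf F /\ exists a, F a /\ le a (e Q).

Definition upc (X : Q -> Prop) : Q -> Prop := fun y => exists x, X x /\ le x y.

Definition dom (A : Q -> Prop) : Q -> Prop := upc (img (@star Q) A).
Definition ran (A : Q -> Prop) : Q -> Prop := upc (img (@plus Q) A).

(* the product (AB)^up; only meaningful when dom A = ran B *)
Definition fprod (A B : Q -> Prop) : Q -> Prop :=
  upc (fun y => exists a b, A a /\ B b /\ y = mul a b).
End Filters.
Arguments bot {Q}. Arguments cpf {Q}. Arguments identity_cpf {Q}. Arguments upc {Q}.
Arguments dom {Q}. Arguments ran {Q}. Arguments fprod {Q}.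

(* E is an identity arrow of the partial category (C(Q), .) where
   A.B is defined iff dom A = ran B *)
Definition cat_identity {Q : RQF} (E : Q -> Prop) : Prop :=
  cpf E /\ dom E = E /\ ran E = E /\
  (forall X, cpf X -> dom X = ran E -> fprod X E = X) /\
  (forall X, cpf X -> dom E = ran X -> fprod E X = X).

(* Main.v *)
Require Import Defs.
From Stdlib Require Import FunctionalExtensionality PropExtensionality.

(* Completely prime filters are handled through the filter bases generating
   them: [upc X] is a completely prime filter as soon as X is nonempty,
   down-directed, avoids 0 and is "prime" (if x <= \/S for some x in X, then
   some s in S lies above an element of X).  Both d(A) = (A* )^ and
   (AB)^ are presented in this form.  Primeness of d(A) comes from the
   decomposition a = a a* = \/_s a (a* /\ s); primeness of (AB)^ from the
   fact that every element of a completely prime filter lies above a partial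
   isometry of the filter, together with the matching condition d(A) = r(B),
   which lets us shrink b so that b+ <= a* and hence (ab)* = b*.

   The axioms are symmetric under reversing the multiplication and swapping
   * with +; this "opposite" restriction quantal frame [opRQF Q] turns r into
   d and (AB)^ into (BA)^, so every statement about ranges is obtained from
   the corresponding statement about domains.  Finally, d(A), r(A) and the
   identity completely prime filters are exactly the upsets of sets of
   projections, which are fixed by d and r; this yields the identities. *)

Lemma pred_ext {T : Type} (P R : T -> Prop) : (forall x, P x <-> R x) -> P = R.
Proof.
  intro H. apply functional_extensionality; intro x.
  apply propositional_extensionality, H.
Qed.

Lemma join_pair_le {Q : RQF} {a b : Q} : le a b -> join (fun x => x = a \/ x = b) = b.
Proof.
  intro H. apply le_antisym.
  - apply join_least. intros x [-> | ->]; [exact H | apply le_refl].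
  - apply join_ub. right; reflexivity.
Qed.

Lemma join_hom_mono {Q : RQF} (f : Q -> Q) :
  (forall S, f (join S) = join (img f S)) -> forall a b, le a b -> le (f a) (f b).
Proof.
  intros Hf a b H. rewrite <- (join_pair_le H), Hf.
  apply join_ub. exists a. split; [left |]; reflexivity.
Qed.

Lemma join_hom_bot {Q : RQF} (f : Q -> Q) :
  (forall S, f (join S) = join (img f S)) -> f bot = bot.
Proof.
  intro Hf. apply le_antisym.
  - unfold bot at 1. rewrite Hf. apply join_least. intros x [s [[] _]].
  - apply join_least. intros a [].
Qed.

Lemma le_bot_eq {Q : RQF} {x : Q} : le x bot -> x = bot.
Proof. intro H. apply le_antisym; [exact H | apply join_least; intros a []]. Qed.

Lemma meet_eq_l {Q : RQF} {a b : Q} : le a b -> meet a b = a.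
Proof.
  intro H. apply le_antisym; [apply meet_lb1 | apply meet_greatest; [apply le_refl | exact H]].
Qed.

Definition partial_isometry {Q : RQF} (x : Q) : Prop :=
  forall b, le b x -> b = mul (plus b) x /\ b = mul x (star b).

(* The two restriction equations may be listed in either order; this is what
   makes the partial isometries of Q those of the opposite frame. *)
Lemma partial_isometry_swap {Q : RQF} (x : Q) :
  (forall b, le b x -> b = mul x (star b) /\ b = mul (plus b) x) <-> partial_isometry x.
Proof. split; intros H b Hb; apply and_comm, H, Hb. Qed.

Definition opRQF (Q : RQF) : RQF.
Proof.
  refine {| car := car Q; le := @le Q; join := @join Q; meet := @meet Q;
            mul := fun a b => mul b a; e := e Q; star := @plus Q; plus := @star Q;
            le_refl := @le_refl Q; le_trans := @le_trans Q; le_antisym := @le_antisym Q;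
            join_ub := @join_ub Q; join_least := @join_least Q;
            meet_lb1 := @meet_lb1 Q; meet_lb2 := @meet_lb2 Q;
            meet_greatest := @meet_greatest Q; meet_join_distr := @meet_join_distr Q;
            mulA := fun a b c => eq_sym (mulA Q c b a);
            mul_join_l := fun a S => mul_join_r Q a S;
            mul_join_r := fun a S => mul_join_l Q a S;
            mul_e_l := @mul_e_r Q; mul_e_r := @mul_e_l Q;
            proj_mul_closed := fun a b ha hb => proj_mul_closed Q b a hb ha;
            proj_comm := fun a b ha hb => proj_comm Q b a hb ha;
            proj_idem := @proj_idem Q;
            star_join := @plus_join Q; plus_join := @star_join Q;
            star_proj := @plus_proj Q; plus_proj := @star_proj Q;
            star_fix := @plus_fix Q; plus_fix := @star_fix Q;
            mul_star := @plus_mul Q; plus_mul := @mul_star Q;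
            star_mul := fun a b => plus_mul2 Q b a;
            plus_mul2 := fun a b => star_mul Q b a |}.
  - cbn. rewrite top_pi. f_equal. apply pred_ext; intro x. symmetry. apply partial_isometry_swap.
  - cbn. intros a b Ha Hb. apply (partial_isometry_swap (mul b a)).
    exact (pi_mul Q b a (proj1 (partial_isometry_swap b) Hb) (proj1 (partial_isometry_swap a) Ha)).
Defined.

Lemma fprod_op {Q : RQF} (A B : Q -> Prop) : @fprod (opRQF Q) A B = fprod B A.
Proof.
  apply pred_ext; intro y; split;
    intros [x [[a [b [Ha [Hb ->]]]] Hx]]; eexists; (split; [| exact Hx]);
    exists b, a; auto.
Qed.

Lemma mul_mono_r {Q : RQF} (c : Q) {a b : Q} : le a b -> le (mul c a) (mul c b).
Proof. apply join_hom_mono, mul_join_l. Qed.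

Lemma mul_mono_l {Q : RQF} (c : Q) {a b : Q} : le a b -> le (mul a c) (mul b c).
Proof. exact (@mul_mono_r (opRQF Q) c a b). Qed.

Lemma star_mono {Q : RQF} {a b : Q} : le a b -> le (star a) (star b).
Proof. apply join_hom_mono, star_join. Qed.

Lemma plus_mono {Q : RQF} {a b : Q} : le a b -> le (plus a) (plus b).
Proof. exact (@star_mono (opRQF Q) a b). Qed.

Lemma mul_mono {Q : RQF} {a b c d : Q} : le a b -> le c d -> le (mul a c) (mul b d).
Proof. intros H1 H2. exact (le_trans _ _ _ _ (mul_mono_l c H1) (mul_mono_r b H2)). Qed.

(* Since a = a a*, only 0 has domain 0. *)
Lemma star_eq_bot {Q : RQF} {x : Q} : star x = bot -> x = bot.
Proof.
  intro H. rewrite <- (mul_star _ x), H. apply join_hom_bot, mul_join_l.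
Qed.

Lemma proj_mul_le {Q : RQF} {f g : Q} : le f (e Q) -> le g (e Q) -> le f g -> mul f g = f.
Proof.
  intros Hf Hg H. apply le_antisym.
  - rewrite <- (mul_e_r _ f) at 2. apply mul_mono_r, Hg.
  - rewrite <- (proj_idem _ f Hf) at 1. apply mul_mono_r, H.
Qed.

Lemma mul_proj_le_r {Q : RQF} (x : Q) {f : Q} : le f (e Q) -> le (mul x f) x.
Proof. intro H. rewrite <- (mul_e_r _ x) at 2. apply mul_mono_r, H. Qed.

Lemma mul_proj_le_l {Q : RQF} (x : Q) {f : Q} : le f (e Q) -> le (mul f x) x.
Proof. exact (@mul_proj_le_r (opRQF Q) x f). Qed.

Lemma star_mul_proj {Q : RQF} (a : Q) {f : Q} : le f (e Q) -> star (mul a f) = mul (star a) f.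
Proof. intro H. rewrite star_mul. apply star_fix, proj_mul_closed; [apply star_proj | exact H]. Qed.

Lemma absorb_r {Q : RQF} {f x : Q} : le f (e Q) -> le (star x) f -> mul x f = x.
Proof.
  intros Hf H. rewrite <- (mul_star _ x) at 1. rewrite <- mulA.
  rewrite (proj_mul_le (star_proj _ x) Hf H). apply mul_star.
Qed.

Lemma star_mul_absorb {Q : RQF} {a b : Q} : le (plus b) (star a) -> star (mul a b) = star b.
Proof.
  intro H. rewrite star_mul. f_equal.
  exact (@absorb_r (opRQF Q) (star a) b (star_proj _ a) H).
Qed.

Lemma partial_isometry_down {Q : RQF} {s t : Q} :
  partial_isometry s -> le t s -> partial_isometry t.
Proof.
  intros Hs Hts c Hct.
  destruct (Hs c (le_trans _ _ _ _ Hct Hts)) as [Ec1 Ec2].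
  destruct (Hs t Hts) as [Et1 Et2].
  split.
  - rewrite Et1, mulA, (proj_mul_le (plus_proj _ c) (plus_proj _ t) (plus_mono Hct)).
    exact Ec1.
  - rewrite Et2, <- mulA, (proj_comm _ _ _ (star_proj _ t) (star_proj _ c)).
    rewrite (proj_mul_le (star_proj _ c) (star_proj _ t) (star_mono Hct)). exact Ec2.
Qed.

Section CpfAxioms.
Context {Q : RQF} {A : Q -> Prop} (HA : cpf A).
Lemma cpf_ne : exists a, A a.
Proof. apply HA. Qed.
Lemma cpf_up {a b : Q} : A a -> le a b -> A b.
Proof. apply HA. Qed.
Lemma cpf_meet {a b : Q} : A a -> A b -> A (meet a b).
Proof. apply HA. Qed.
Lemma cpf_nbot : ~ A bot.
Proof. apply HA. Qed.
Lemma cpf_cp {S : Q -> Prop} : A (join S) -> exists a, S a /\ A a.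
Proof. apply HA. Qed.
End CpfAxioms.

(* Since the top element is a join of partial isometries and the frame law
   holds, every element a of a completely prime filter lies above a partial
   isometry that still belongs to the filter. *)
Lemma cpf_partial_isometry {Q : RQF} {A : Q -> Prop} {a : Q} :
  cpf A -> A a -> exists p, A p /\ partial_isometry p /\ le p a.
Proof.
  intros HA Ha.
  assert (Hsplit : a = join (img (meet a) partial_isometry)).
  { rewrite <- meet_join_distr. symmetry. apply meet_eq_l.
    unfold partial_isometry. rewrite <- top_pi. apply join_ub. exact I. }
  rewrite Hsplit in Ha. destruct (cpf_cp HA Ha) as [t [[p [Hp ->]] Ht]].
  exists (meet a p). split; [exact Ht | split; [| apply meet_lb1]].
  exact (partial_isometry_down Hp (meet_lb2 _ a p)).
Qed.

Lemma upc_cpf {Q : RQF} (X : Q -> Prop) :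
  (exists x, X x) ->
  (forall x y, X x -> X y -> exists z, X z /\ le z x /\ le z y) ->
  (forall x, X x -> x <> bot) ->
  (forall x S, X x -> le x (join S) -> exists s, S s /\ upc X s) ->
  cpf (upc X).
Proof.
  intros [x0 Hx0] Hdir Hnbot Hprime.
  split; [| split; [| split; [| split]]].
  - exists x0, x0. split; [exact Hx0 | apply le_refl].
  - intros a b [x [Hx Hxa]] Hab. exists x. split; [exact Hx | exact (le_trans _ _ _ _ Hxa Hab)].
  - intros a b [x [Hx Hxa]] [y [Hy Hyb]].
    destruct (Hdir x y Hx Hy) as [z [Hz [Hzx Hzy]]].
    exists z. split; [exact Hz |].
    apply meet_greatest; [exact (le_trans _ _ _ _ Hzx Hxa) | exact (le_trans _ _ _ _ Hzy Hyb)].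
  - intros [x [Hx Hxb]]. exact (Hnbot x Hx (le_bot_eq Hxb)).
  - intros S [x [Hx HxS]]. exact (Hprime x S Hx HxS).
Qed.

Lemma img_in {Q : RQF} (f : Q -> Q) {A : Q -> Prop} {a : Q} : A a -> img f A (f a).
Proof. intro Ha. exists a. split; [exact Ha | reflexivity]. Qed.

Lemma upc_in {Q : RQF} {X : Q -> Prop} {x : Q} : X x -> upc X x.
Proof. intro Hx. exists x. split; [exact Hx | apply le_refl]. Qed.

(* Primeness of the base A* of d(A): from a* <= \/S and the decomposition
   a = \/_s a (a* /\ s), some a (a* /\ s) lies in A, and its domain is <= s. *)
Lemma dom_prime {Q : RQF} {A : Q -> Prop} {a : Q} (S : Q -> Prop) :
  cpf A -> A a -> le (star a) (join S) -> exists s, S s /\ dom A s.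
Proof.
  intros HA Ha HaS.
  assert (Hsplit : a = join (img (mul a) (img (meet (star a)) S))).
  { rewrite <- mul_join_l, <- meet_join_distr, (meet_eq_l HaS). symmetry. apply mul_star. }
  rewrite Hsplit in Ha.
  destruct (cpf_cp HA Ha) as [t [[w [[s [Hs ->]] ->]] Ht]].
  exists s. split; [exact Hs |].
  exists (star (mul a (meet (star a) s))). split; [exact (img_in star Ht) |].
  assert (Hproj : le (meet (star a) s) (e Q)).
  { eapply le_trans; [apply meet_lb1 | apply star_proj]. }
  rewrite (star_mul_proj a Hproj).
  eapply le_trans; [apply mul_proj_le_l, star_proj | apply meet_lb2].
Qed.

Lemma dom_cpf {Q : RQF} {A : Q -> Prop} : cpf A -> cpf (dom A).
Proof.
  intro HA. apply upc_cpf.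
  - destruct (cpf_ne HA) as [a Ha]. exists (star a). exact (img_in star Ha).
  - intros x y [a [Ha ->]] [b [Hb ->]].
    exists (star (meet a b)). split; [exact (img_in star (cpf_meet HA Ha Hb)) |].
    split; apply star_mono; [apply meet_lb1 | apply meet_lb2].
  - intros x [a [Ha ->]] Hbot. apply (cpf_nbot HA). rewrite <- (star_eq_bot Hbot). exact Ha.
  - intros x S [a [Ha ->]] HaS. exact (dom_prime S HA Ha HaS).
Qed.

Lemma ran_cpf {Q : RQF} {A : Q -> Prop} : cpf A -> cpf (ran A).
Proof. exact (@dom_cpf (opRQF Q) A). Qed.

Lemma refine_right {Q : RQF} {A B : Q -> Prop} {a b : Q} :
  cpf B -> dom A = ran B -> A a -> B b ->
  exists b', B b' /\ le b' b /\ le (plus b') (star a).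
Proof.
  intros HB HAB Ha Hb.
  assert (Hd : ran B (star a)) by (rewrite <- HAB; exact (upc_in (img_in star Ha))).
  destruct Hd as [x [[b1 [Hb1 ->]] Hx]].
  exists (meet b b1). split; [exact (cpf_meet HB Hb Hb1) | split; [apply meet_lb1 |]].
  exact (le_trans _ _ _ _ (plus_mono (meet_lb2 _ b b1)) Hx).
Qed.

(* Products of matching filters avoid 0: ab = 0 forces (ab')* = b'* = 0. *)
Lemma fprod_nbot {Q : RQF} {A B : Q -> Prop} {a b : Q} :
  cpf B -> dom A = ran B -> A a -> B b -> mul a b <> bot.
Proof.
  intros HB HAB Ha Hb Hbot.
  destruct (refine_right HB HAB Ha Hb) as [b' [Hb' [Hle Hpl]]].
  assert (Hz : mul a b' = bot).
  { apply le_bot_eq. rewrite <- Hbot. apply mul_mono_r, Hle. }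
  assert (Hstar : star b' = bot).
  { rewrite <- (star_mul_absorb Hpl), Hz. apply join_hom_bot, star_join. }
  apply (cpf_nbot HB). rewrite <- (star_eq_bot Hstar). exact Hb'.
Qed.

Lemma fprod_in {Q : RQF} {A B : Q -> Prop} {a b : Q} : A a -> B b -> fprod A B (mul a b).
Proof. intros Ha Hb. apply upc_in. exists a, b. auto. Qed.

(* Replace a, b by partial isometries a1, b2 below
   them with b2+ <= a1*; then x = a1 b2 is a partial isometry with x* = b2*,
   so b2 = \/_s b2 (x /\ s)*, and a1 b2 (x /\ s)* = x /\ s <= s. *)
Lemma fprod_prime {Q : RQF} {A B : Q -> Prop} {a b : Q} (S : Q -> Prop) :
  cpf A -> cpf B -> dom A = ran B -> A a -> B b -> le (mul a b) (join S) ->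
  exists s, S s /\ fprod A B s.
Proof.
  intros HA HB HAB Ha Hb HabS.
  destruct (cpf_partial_isometry HA Ha) as [a1 [Ha1 [Pa1 Ha1a]]].
  destruct (cpf_partial_isometry HB Hb) as [b1 [Hb1 [Pb1 Hb1b]]].
  destruct (refine_right HB HAB Ha1 Hb1) as [b2 [Hb2 [Hb21 Hpl]]].
  set (x := mul a1 b2).
  assert (Px : partial_isometry x).
  { exact (pi_mul _ _ _ Pa1 (partial_isometry_down Pb1 Hb21)). }
  assert (HxS : le x (join S)).
  { exact (le_trans _ _ _ _ (mul_mono Ha1a (le_trans _ _ _ _ Hb21 Hb1b)) HabS). }
  assert (Hsplit : b2 = join (img (mul b2) (img star (img (meet x) S)))).
  { rewrite <- mul_join_l, <- star_join, <- meet_join_distr, (meet_eq_l HxS).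
    unfold x. rewrite (star_mul_absorb Hpl). symmetry. apply mul_star. }
  rewrite Hsplit in Hb2.
  destruct (cpf_cp HB Hb2) as [t [[w [[c [[s [Hs ->]] ->]] ->]] Ht]].
  exists s. split; [exact Hs |].
  exists (mul a1 (mul b2 (star (meet x s)))). split.
  - exists a1, (mul b2 (star (meet x s))). auto.
  - rewrite mulA. fold x. rewrite <- (proj2 (Px (meet x s) (meet_lb1 _ _ _))).
    apply meet_lb2.
Qed.

Lemma fprod_cpf {Q : RQF} {A B : Q -> Prop} :
  cpf A -> cpf B -> dom A = ran B -> cpf (fprod A B).
Proof.
  intros HA HB HAB. apply upc_cpf.
  - destruct (cpf_ne HA) as [a Ha]. destruct (cpf_ne HB) as [b Hb].
    exists (mul a b), a, b. auto.
  - intros x y [a1 [b1 [Ha1 [Hb1 ->]]]] [a2 [b2 [Ha2 [Hb2 ->]]]].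
    exists (mul (meet a1 a2) (meet b1 b2)). split.
    + exists (meet a1 a2), (meet b1 b2).
      split; [exact (cpf_meet HA Ha1 Ha2) | split; [exact (cpf_meet HB Hb1 Hb2) | reflexivity]].
    + split; apply mul_mono; [apply meet_lb1 | apply meet_lb1 | apply meet_lb2 | apply meet_lb2].
  - intros x [a [b [Ha [Hb ->]]]]. exact (fprod_nbot HB HAB Ha Hb).
  - intros x S [a [b [Ha [Hb ->]]]] HxS. exact (fprod_prime S HA HB HAB Ha Hb HxS).
Qed.

Lemma dom_fprod {Q : RQF} {A B : Q -> Prop} :
  cpf A -> cpf B -> dom A = ran B -> dom (fprod A B) = dom B.
Proof.
  intros HA HB HAB. apply pred_ext; intro y. split.
  - intros [z [[u [[v [[a [b [Ha [Hb ->]]]] Hv]] ->]] Hz]].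
    destruct (refine_right HB HAB Ha Hb) as [b' [Hb' [Hle Hpl]]].
    exists (star b'). split; [exact (img_in star Hb') |].
    rewrite <- (star_mul_absorb Hpl). eapply le_trans; [| exact Hz].
    apply star_mono. exact (le_trans _ _ _ _ (mul_mono_r a Hle) Hv).
  - intros [z [[b [Hb ->]] Hz]].
    destruct (cpf_ne HA) as [a Ha].
    destruct (refine_right HB HAB Ha Hb) as [b' [Hb' [Hle Hpl]]].
    exists (star (mul a b')). split; [exact (img_in star (fprod_in Ha Hb')) |].
    rewrite (star_mul_absorb Hpl). exact (le_trans _ _ _ _ (star_mono Hle) Hz).
Qed.

Lemma ran_fprod {Q : RQF} {A B : Q -> Prop} :
  cpf A -> cpf B -> dom A = ran B -> ran (fprod A B) = ran A.
Proof.
  intros HA HB HAB.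
  pose proof (@dom_fprod (opRQF Q) B A HB HA (eq_sym HAB)) as Hop.
  rewrite fprod_op in Hop. exact Hop.
Qed.

Lemma fprod_assoc {Q : RQF} (A B C : Q -> Prop) : fprod (fprod A B) C = fprod A (fprod B C).
Proof.
  apply pred_ext; intro y; split.
  - intros [x [[u [c [[w [[a [b [Ha [Hb ->]]]] Hw]] [Hc ->]]]] Hx]].
    exists (mul a (mul b c)). split.
    + exists a, (mul b c). split; [exact Ha | split; [exact (fprod_in Hb Hc) | reflexivity]].
    + rewrite mulA. exact (le_trans _ _ _ _ (mul_mono_l c Hw) Hx).
  - intros [x [[a [v [Ha [[w [[b [c [Hb [Hc ->]]]] Hw]] ->]]]] Hx]].
    exists (mul (mul a b) c). split.
    + exists (mul a b), c. split; [exact (fprod_in Ha Hb) | split; [exact Hc | reflexivity]].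
    + rewrite <- mulA. exact (le_trans _ _ _ _ (mul_mono_r a Hw) Hx).
Qed.

Lemma fprod_dom {Q : RQF} {X : Q -> Prop} : cpf X -> fprod X (dom X) = X.
Proof.
  intro HX. apply pred_ext; intro y; split.
  - intros [u [[x [d [Hx [[v [[x' [Hx' ->]] Hv]] ->]]]] Hu]].
    apply (cpf_up HX (cpf_meet HX Hx Hx')).
    rewrite <- (mul_star _ (meet x x')). eapply le_trans; [| exact Hu].
    apply mul_mono; [apply meet_lb1 |].
    exact (le_trans _ _ _ _ (star_mono (meet_lb2 _ x x')) Hv).
  - intro Hy. rewrite <- (mul_star _ y). exact (fprod_in Hy (upc_in (img_in star Hy))).
Qed.

Lemma fprod_ran {Q : RQF} {X : Q -> Prop} : cpf X -> fprod (ran X) X = X.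
Proof. intro HX. rewrite <- fprod_op. exact (@fprod_dom (opRQF Q) X HX). Qed.

Lemma dom_upc_proj {Q : RQF} {P : Q -> Prop} :
  (forall p, P p -> le p (e Q)) -> dom (upc P) = upc P.
Proof.
  intro HP. apply pred_ext; intro y; split.
  - intros [u [[x [[p [Hp Hpx]] ->]] Hu]].
    exists p. split; [exact Hp |].
    rewrite <- (star_fix _ p (HP p Hp)). exact (le_trans _ _ _ _ (star_mono Hpx) Hu).
  - intros [p [Hp Hpy]]. exists (star p). split; [exact (img_in star (upc_in Hp)) |].
    rewrite (star_fix _ p (HP p Hp)). exact Hpy.
Qed.

Lemma ran_upc_proj {Q : RQF} {P : Q -> Prop} :
  (forall p, P p -> le p (e Q)) -> ran (upc P) = upc P.
Proof. exact (@dom_upc_proj (opRQF Q) P). Qed.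

Lemma img_star_proj {Q : RQF} (A : Q -> Prop) : forall p, img star A p -> le p (e Q).
Proof. intros p [a [_ ->]]. apply star_proj. Qed.

Lemma img_plus_proj {Q : RQF} (A : Q -> Prop) : forall p, img plus A p -> le p (e Q).
Proof. exact (@img_star_proj (opRQF Q) A). Qed.

(* A completely prime filter containing a projection f is generated by its
   projections, since y /\ f lies in it for every y in it. *)
Lemma identity_cpf_upc {Q : RQF} {E : Q -> Prop} :
  identity_cpf E -> E = upc (fun p => E p /\ le p (e Q)).
Proof.
  intros [HE [f [Hf Hfe]]]. apply pred_ext; intro y; split.
  - intro Hy. exists (meet y f). split; [split |].
    + exact (cpf_meet HE Hy Hf).
    + exact (le_trans _ _ _ _ (meet_lb2 _ y f) Hfe).
    + apply meet_lb1.
  - intros [p [[Hp _] Hpy]]. exact (cpf_up HE Hp Hpy).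
Qed.

Lemma cat_identity_of {Q : RQF} {E : Q -> Prop} :
  cpf E -> dom E = E -> ran E = E -> cat_identity E.
Proof.
  intros HE Hd Hr. split; [exact HE | split; [exact Hd | split; [exact Hr | split]]].
  - intros X HX H. rewrite Hr in H. rewrite <- H. exact (fprod_dom HX).
  - intros X HX H. rewrite Hd in H. rewrite H. exact (fprod_ran HX).
Qed.

Lemma identity_cpf_cat_identity {Q : RQF} {E : Q -> Prop} :
  identity_cpf E -> cat_identity E.
Proof.
  intro HE. pose proof (identity_cpf_upc HE) as Hup.
  apply cat_identity_of; [apply HE | |]; rewrite Hup;
    [apply dom_upc_proj | apply ran_upc_proj]; intros p Hp; apply Hp.
Qed.

Lemma cat_identity_identity_cpf {Q : RQF} {E : Q -> Prop} :
  cat_identity E -> identity_cpf E.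
Proof.
  intros [HE [Hd _]]. split; [exact HE |].
  destruct (cpf_ne HE) as [a Ha]. exists (star a). split; [| apply star_proj].
  rewrite <- Hd. exact (upc_in (img_in star Ha)).
Qed.

Lemma dom_cat_identity {Q : RQF} {A : Q -> Prop} : cpf A -> cat_identity (dom A).
Proof.
  intro HA. apply cat_identity_of; [exact (dom_cpf HA) | |].
  - exact (dom_upc_proj (img_star_proj A)).
  - exact (ran_upc_proj (img_star_proj A)).
Qed.

Lemma ran_cat_identity {Q : RQF} {A : Q -> Prop} : cpf A -> cat_identity (ran A).
Proof.
  intro HA. apply cat_identity_of; [exact (ran_cpf HA) | |].
  - exact (dom_upc_proj (img_plus_proj A)).
  - exact (ran_upc_proj (img_plus_proj A)).
Qed.

Theorem mainTheorem9 (Q : RQF) :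
  (* the product of composable completely prime filters is a completely prime filter *)
  (forall A B : Q -> Prop, cpf A -> cpf B -> dom A = ran B -> cpf (fprod A B)) /\
  (* d(A) and r(A) are completely prime filters, and composition matches domains/codomains *)
  (forall A : Q -> Prop, cpf A -> cpf (dom A) /\ cpf (ran A)) /\
  (forall A B : Q -> Prop, cpf A -> cpf B -> dom A = ran B ->
     dom (fprod A B) = dom B /\ ran (fprod A B) = ran A) /\
  (* associativity *)
  (forall A B C : Q -> Prop, cpf A -> cpf B -> cpf C -> dom A = ran B -> dom B = ran C ->
     fprod (fprod A B) C = fprod A (fprod B C)) /\
  (* d(A) is a right identity and r(A) a left identity of A *)
  (forall A : Q -> Prop, cpf A ->
     cat_identity (dom A) /\ cat_identity (ran A) /\
     dom A = ran (dom A) /\ fprod A (dom A) = A /\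
     dom (ran A) = ran A /\ fprod (ran A) A = A) /\
  (* the identities are exactly the identity completely prime filters *)
  (forall E : Q -> Prop, cpf E -> (cat_identity E <-> identity_cpf E)).
Proof.
  split; [intros A B HA HB HAB; exact (fprod_cpf HA HB HAB) |].
  split; [intros A HA; exact (conj (dom_cpf HA) (ran_cpf HA)) |].
  split; [intros A B HA HB HAB; exact (conj (dom_fprod HA HB HAB) (ran_fprod HA HB HAB)) |].
  split; [intros; apply fprod_assoc |].
  split.
  - intros A HA. pose proof (dom_cat_identity HA) as Hd. pose proof (ran_cat_identity HA) as Hr.
    split; [exact Hd | split; [exact Hr |]].
    split; [symmetry; apply Hd | split; [exact (fprod_dom HA) |]].
    split; [apply Hr | exact (fprod_ran HA)].
  - intros E _. split; [apply cat_identity_identity_cpf | apply identity_cpf_cat_identity].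
Qed.
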